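(* Let $D$ be a division ring and let $n$ be a positive integer. If the center of $D$ is the field of two elements, then every matrix in $\mathrm{M}_n(D)$ can be written as a sum of three diagonalizable matrices in $\mathrm{M}_n(D)$. Moreover, the number $3$ is sharp: it cannot in general be replaced by $2$, i.e. there exist a division ring $D$ whose center is the field of two elements, a positive integer $n$, and a matrix in $\mathrm{M}_n(D)$ that is not a sum of two diagonalizable matrices in $\mathrm{M}_n(D)$.
   Context: $\mathrm{M}_n(D)$ is the ring of $n\times n$ matrices over $D$. A square matrix over $D$ is diagonalizable if it is similar over $D$ (conjugate by an invertible matrix over $D$) to a diagonal matrix with entries in $D$. Division rings may be commutative or noncommutative; in particular $D$ may be the field of two elements itself. *)

(* Defs.v *)
From HB Require Import structures.
From mathcomp Require Import all_boot all_order all_algebra.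

Set Implicit Arguments.
Unset Strict Implicit.
Unset Printing Implicit Defensive.

Import GRing.Theory.
Local Open Scope ring_scope.

(* Multiplication in a unitRingType need not be commutative, and its rings are
   nontrivial by definition. *)
Definition division_ring (D : unitRingType) : Prop :=
  forall x : D, x != 0 -> x \is a GRing.unit.

Definition central (R : nzRingType) (x : R) : Prop :=
  forall y : R, GRing.comm x y.

Definition center_is_F2 (R : nzRingType) : Prop :=
  exists f : {rmorphism 'F_2 -> R},
    injective f /\ (forall x : R, central x <-> exists a : 'F_2, x = f a).

(* The library's [unitmx], [invmx] and [diagonalizable] require commutative
   coefficients, hence the explicit two-sided inverse. *)
Definition inverse_mx (R : nzRingType) (n : nat) (P Q : 'M[R]_n) : Prop :=
  P *m Q = 1%:M /\ Q *m P = 1%:M.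

Definition similar_mx (R : nzRingType) (n : nat) (A B : 'M[R]_n) : Prop :=
  exists P Q : 'M[R]_n, inverse_mx P Q /\ A = P *m B *m Q.

Definition diagonalizable_mx (R : nzRingType) (n : nat) (A : 'M[R]_n) : Prop :=
  exists d : 'rV[R]_n, similar_mx A (diag_mx d).

(* Main.v *)
(** Every square matrix over a division ring is similar to a direct sum of
    companion matrices.  To split one off, take [p] maximal such that some row
    [v] and column [phi] satisfy [v A^j phi = 0] for [j < p] and
    [v A^p phi = 1].  The Hankel matrix [(v A^(i+j) phi)], [i, j <= p], is then
    invertible, and by maximality [v A^(p+1)] and [A^(p+1) phi] lie in the spans
    of the lower powers; hence [A] commutes with a projection onto the cyclic
    space generated by [v], and acts on its image by a companion matrix.

    In characteristic 2 a nilpotent Jordan block, possibly with its last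
    diagonal entry increased by 1, is a sum of two idempotents.  It differs from
    a companion matrix only in the last row, and the increment can be chosen so
    that this difference has a nonzero last diagonal entry; a matrix of rank one
    with such a row is diagonalizable.

    For sharpness, diagonalizable matrices over F_2 are idempotent, and if
    [A = P + Q] with [P], [Q] idempotent and [A^2 = A + 1], then [PQ + QP = 1],
    so that [P = P(PQ + QP)P = 2 PQP = 0], which is absurd. *)
Require Import Defs.
From HB Require Import structures.
From mathcomp Require Import all_boot all_order all_algebra.
From Stdlib Require Import Classical_Prop.

Set Implicit Arguments.
Unset Strict Implicit.
Unset Printing Implicit Defensive.

Import GRing.Theory.
Local Open Scope ring_scope.

Lemma ltn_ord_max n (i : 'I_n.+1) : i != ord_max -> (i < n)%N.
Proof. by move=> i_neq; rewrite ltn_neqAle leq_ord andbT. Qed.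

(** * Linear algebra over a division ring *)

Section DivisionRing.

Variable D : unitRingType.
Hypothesis D_div : division_ring D.

(** Induction on columns: without the first column there are two solutions [x] and [y], with [y]
    zero at an index [j] where [x] is not. If [y] does not already kill the first column, some
    [x - c y] does, and its entry at [j] is still nonzero. *)
Lemma left_kernel_nontrivial n k (M : 'M[D]_(k, n)) :
  (n < k)%N -> exists2 x : 'rV_k, x != 0 & x *m M = 0.
Proof.
elim: n k M => [|n IHn] [//|k] M ltnk.
  exists (const_mx 1); last by rewrite [LHS]thinmx0.
  by apply/rV0Pn; exists 0; rewrite mxE oner_eq0.
pose a := lsubmx (M : 'M_(k.+1, 1 + n)).
pose M1 := rsubmx (M : 'M_(k.+1, 1 + n)).
have ME (z : 'rV_k.+1) : z *m M1 = 0 -> (z *m a) 0 0 = 0 -> z *m M = 0.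
  move=> zM1 za; rewrite -[M](hsubmxK (M : 'M_(k.+1, 1 + n))).
  rewrite -[LHS]/(z *m row_mx a M1) mul_mx_row zM1.
  have -> : z *m a = 0 by apply/rowP=> i; rewrite ord1 za mxE.
  by rewrite row_mx0.
have [x x_neq0 xM1] := IHn _ M1 (ltnW ltnk).
have /rV0Pn[j xj_neq0] := x_neq0.
have [y' y'_neq0 y'M1] := IHn _ (row' j M1) ltnk.
pose y := y' *m row' j 1%:M.
have yj : y 0 j = 0.
  rewrite mxE big1 // => i _.
  by rewrite !mxE eq_sym (negPf (neq_lift _ _)) mulr0.
have yE i : y 0 (lift j i) = y' 0 i.
  rewrite mxE (bigD1 i) //= !mxE eqxx mulr1 big1 ?addr0 // => l l_neqi.
  by rewrite !mxE (inj_eq lift_inj) (negPf l_neqi) mulr0.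
have y_neq0 : y != 0.
  have /rV0Pn[i y'i] := y'_neq0.
  by apply/rV0Pn; exists (lift j i); rewrite yE.
have yM1 : y *m M1 = 0.
  by rewrite -mulmxA row'Esub mul_rowsub_mx mul1mx -row'Esub.
clearbody y => {y' y'_neq0 y'M1 yE}.
have [ya|ya_neq0] := eqVneq ((y *m a) 0 0) 0.
  by exists y => //; apply: ME.
exists (x - ((x *m a) 0 0 * ((y *m a) 0 0)^-1) *: y).
  by apply/rV0Pn; exists j; rewrite !mxE yj mulr0 subr0.
apply: ME; rewrite mulmxBl -scalemxAl; first by rewrite xM1 yM1 scaler0 subr0.
rewrite mxE [X in _ + X]mxE [X in _ - X]mxE mulrVK ?subrr //.
exact: D_div.
Qed.


Lemma right_inverse_leq k n (K : 'M[D]_(k, n)) (R : 'M_(n, k)) :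
  K *m R = 1%:M -> (k <= n)%N.
Proof.
move=> KR; rewrite leqNgt.
apply/negP=> /(left_kernel_nontrivial K)[x x_neq0 xK].
by rewrite -[x]mulmx1 -KR mulmxA xK mul0mx eqxx in x_neq0.
Qed.

Lemma row_dual n (u : 'rV[D]_n) : u != 0 -> exists z : 'cV_n, u *m z = 1%:M.
Proof.
move=> /rV0Pn[j uj]; exists (\col_i ((i == j)%:R / u 0 j)).
apply/rowP=> i; rewrite ord1 !mxE (bigD1 j) //= big1 => [|l /negPf lj].
  by rewrite mxE eqxx mul1r mulrV ?addr0 //; apply: D_div.
by rewrite mxE lj mul0r mulr0.
Qed.

Lemma col_dual n (u : 'cV[D]_n) : u != 0 -> exists z : 'rV_n, z *m u = 1%:M.
Proof.
move=> /cV0Pn[j uj]; exists (\row_i ((u j 0)^-1 *+ (i == j))).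
apply/rowP=> i; rewrite ord1 !mxE (bigD1 j) //= big1 => [|l /negPf lj].
  by rewrite mxE eqxx mulVr ?addr0 //; apply: D_div.
by rewrite mxE lj mul0r.
Qed.

Lemma right_inverse_extend k n (K : 'M[D]_(k, n)) (R : 'M_(n, k)) (u : 'rV_n) :
  K *m R = 1%:M ->
  (exists c : 'rV_k, u = c *m K) \/
  (exists S : 'M_(n, 1 + k), col_mx u K *m S = 1%:M).
Proof.
move=> KR; pose w := u - u *m R *m K.
have [w0|/row_dual[z wz]] := eqVneq w 0.
  by left; exists (u *m R); apply/eqP; rewrite -subr_eq0 -/w w0.
(* [z1] moves [z] into the kernel of [K] while keeping [u z1 = w z = 1]; [R1] then corrects [R] so
   that [u] kills it. *)
right; pose z1 := z - R *m (K *m z); pose R1 := R - z1 *m (u *m R).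
have Kz1 : K *m z1 = 0 by rewrite mulmxBr [K *m (R *m _)]mulmxA KR mul1mx subrr.
have uz1 : u *m z1 = 1%:M by rewrite -wz mulmxBr mulmxBl !mulmxA.
have KR1 : K *m R1 = 1%:M by rewrite mulmxBr [K *m (_ *m _)]mulmxA Kz1 mul0mx subr0.
have uR1 : u *m R1 = 0 by rewrite mulmxBr [u *m (_ *m _)]mulmxA uz1 mul1mx subrr.
exists (row_mx z1 R1).
by rewrite mul_col_row uz1 uR1 Kz1 KR1 [RHS]scalar_mx_block.
Qed.

Lemma right_inverse_exists k n (M : 'M[D]_(k, n)) :
  (forall x : 'rV_k, x *m M = 0 -> x = 0) -> exists R : 'M_(n, k), M *m R = 1%:M.
Proof.
elim: k M => [|k IHk] M injM; first by exists 0; rewrite !flatmx0.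
pose u := usubmx (M : 'M_(1 + k, n)); pose K := dsubmx (M : 'M_(1 + k, n)).
have ME : M = col_mx u K by rewrite vsubmxK.
have [x xK|R KR] := IHk K.
  have : row_mx (0 : 'rV_1) x = 0.
    apply: injM; rewrite ME -[LHS]/(row_mx 0 x *m col_mx u K).
    by rewrite mul_row_col xK mul0mx addr0.
  by rewrite -[0 in RHS]row_mx0 => /eq_row_mx[].
case: (right_inverse_extend u KR) => [[c uE]|[S]]; last first.
  by rewrite -ME; exists S.
have : row_mx (1%:M : 'rV_1) (- c) = 0.
  apply: injM; rewrite ME -[LHS]/(row_mx _ _ *m col_mx u K) mul_row_col.
  by rewrite mul1mx mulNmx -uE subrr.
rewrite -[0 in RHS]row_mx0 => /eq_row_mx[/rowP/(_ 0)/eqP].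
by rewrite !mxE oner_eq0.
Qed.

(** A row [u] of [1 - R M] satisfies [u R = 0]. It cannot be independent of the [n] rows of [M], so
    [u = c M], and then [c = c M R = u R = 0]. *)
Lemma right_inverse_square n (M R : 'M[D]_n) : M *m R = 1%:M -> R *m M = 1%:M.
Proof.
move=> MR; apply/eqP; rewrite eq_sym -subr_eq0; apply/eqP/row_matrixP=> i.
rewrite [RHS]row0; set u := row i _.
have uR : u *m R = 0.
  by rewrite -row_mul mulmxBl mul1mx -mulmxA MR mulmx1 subrr row0.
case: (right_inverse_extend u MR) => [[c uE]|[S /right_inverse_leq]].
  by rewrite uE -[c]mulmx1 -MR mulmxA -uE uR mul0mx.
by rewrite add1n ltnn.
Qed.

(** * Idempotents and diagonalizability *)

Lemma exists_last (P : nat -> Prop) n :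
  P 0%N -> (forall k, P k -> (k <= n)%N) -> exists k, P k /\ ~ P k.+1.
Proof.
move=> P0 Pn; apply: NNPP => noP.
have Pall k : P k.
  by elim: k => // k Pk; apply: NNPP => nPk; apply: noP; exists k.
by have := Pn _ (Pall n.+1); rewrite ltnn.
Qed.

(** A rank factorization: the rows of [Y] form a maximal independent family of vectors fixed by [F].
    Each row of [F] is itself fixed, hence lies in their span. *)
Lemma idempotent_factor n (F : 'M[D]_n) : F *m F = F ->
  exists r (X : 'M_(n, r)) (Y : 'M_(r, n)), Y *m X = 1%:M /\ X *m Y = F.
Proof.
move=> FF.
pose P r := exists (Y : 'M[D]_(r, n)) (R : 'M_(n, r)), Y *m R = 1%:M /\ Y *m F = Y.
have [||r [[Y [R [YR YF]]] maxr]] := @exists_last P n.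
- by exists 0, 0; split; [rewrite !flatmx0 | rewrite mul0mx].
- by move=> k [Y [R [/right_inverse_leq]]].
have /fin_all_exists[f fE] (i : 'I_n) : exists c : 'rV_r, row i F = c *m Y.
  case: (right_inverse_extend (row i F) YR) => // -[S YS]; case: maxr.
  exists (col_mx (row i F) Y), S; split=> //.
  by rewrite -[LHS]/(col_mx (row i F) Y *m F) mul_col_mx YF -row_mul FF.
have XY : (\matrix_i f i) *m Y = F.
  by apply/row_matrixP=> i; rewrite row_mul rowK fE.
exists r, (\matrix_i f i), Y; split=> //.
by rewrite -[LHS]mulmx1 -YR mulmxA -[Y *m _ *m Y]mulmxA XY YF.
Qed.

Lemma complement_factor r n (X : 'M[D]_(n, r)) (Y : 'M_(r, n)) : Y *m X = 1%:M ->
  exists s (X' : 'M_(n, s)) (Y' : 'M_(s, n)),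
    row_mx X X' *m col_mx Y Y' = 1%:M /\ col_mx Y Y' *m row_mx X X' = 1%:M.
Proof.
move=> YX; have YF : Y *m (1%:M - X *m Y) = 0.
  by rewrite mulmxBr mulmx1 mulmxA YX mul1mx subrr.
have FX : (1%:M - X *m Y) *m X = 0.
  by rewrite mulmxBl mul1mx -mulmxA YX mulmx1 subrr.
have [|s [X' [Y' [YX' XY']]]] := @idempotent_factor n (1%:M - X *m Y).
  by rewrite mulmxBl mul1mx -mulmxA YF mulmx0 subr0.
exists s, X', Y'; split; first by rewrite mul_row_col XY' addrC subrK.
rewrite mul_col_row YX YX'.
have -> : Y *m X' = 0.
  by rewrite -[X']mulmx1 -YX' !mulmxA -[Y *m X' *m Y']mulmxA XY' YF mul0mx.
have -> : Y' *m X = 0.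
  by rewrite -[Y']mul1mx -YX' -!mulmxA [X' *m _]mulmxA XY' FX mulmx0.
by rewrite [RHS]scalar_mx_block.
Qed.

(** Rectangular [P] and [Q] allow block sizes such as [r + s], whose equality with [n] is only
    propositional. *)
Lemma diagonalizable_conj m n (P : 'M[D]_(n, m)) (Q : 'M_(m, n)) (B : 'M_m) :
  P *m Q = 1%:M -> Q *m P = 1%:M ->
  diagonalizable_mx B -> diagonalizable_mx (P *m B *m Q).
Proof.
move=> PQ QP; have eq_mn : m = n.
  by apply/eqP; rewrite eqn_leq (right_inverse_leq PQ) (right_inverse_leq QP).
subst n.
move=> [d [P' [Q' [[PQ' QP'] ->]]]].
exists d, (P *m P'), (Q' *m Q); split; last by rewrite !mulmxA.
split; first by rewrite mulmxA -(mulmxA P) PQ' mulmx1.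
by rewrite mulmxA -(mulmxA Q') QP mulmx1.
Qed.

(** Completing [X] and [Y] to a change of basis pads [d] with zeros. Applied to idempotents and to
    matrices of rank one. *)
Lemma diagonalizable_factor r n (X : 'M[D]_(n, r)) (Y : 'M_(r, n)) (d : 'rV_r) :
  Y *m X = 1%:M -> diagonalizable_mx (X *m diag_mx d *m Y).
Proof.
move=> /complement_factor[s [X' [Y' [PQ QP]]]].
have -> : X *m diag_mx d *m Y =
          row_mx X X' *m diag_mx (row_mx d 0) *m col_mx Y Y'.
  by rewrite diag_mx_row mul_row_block mul_row_col linear0 !mulmx0 !addr0 mul0mx addr0.
apply: diagonalizable_conj PQ QP _.
exists (row_mx d 0), 1%:M, 1%:M; rewrite mul1mx mulmx1.
by split=> //; split; rewrite mulmx1.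
Qed.

Lemma idempotent_diagonalizable n (F : 'M[D]_n) :
  F *m F = F -> diagonalizable_mx F.
Proof.
case/idempotent_factor=> r [X [Y [/(diagonalizable_factor (const_mx 1))]]].
by rewrite diag_const_mx mulmx1 => + <-.
Qed.

Lemma diagonalizable_block m n (A : 'M[D]_m) (B : 'M_n) :
  diagonalizable_mx A -> diagonalizable_mx B ->
  diagonalizable_mx (block_mx A 0 0 B).
Proof.
move=> [a [P [Q [[PQ QP] ->]]]] [b [P' [Q' [[PQ' QP'] ->]]]].
exists (row_mx a b), (block_mx P 0 0 P'), (block_mx Q 0 0 Q').
split; first by split; rewrite mulmx_block !mulmx0 !mul0mx !addr0 !add0r
  ?PQ ?QP ?PQ' ?QP' [RHS]scalar_mx_block.
by rewrite diag_mx_row !mulmx_block !mulmx0 !mul0mx !addr0 !add0r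
  ?mulmx0 ?mul0mx ?addr0 ?add0r.
Qed.

(** * Sums of three diagonalizable matrices; companion matrices *)

Definition sum_of_3_diagonalizable n (A : 'M[D]_n) : Prop :=
  exists B1 B2 B3 : 'M[D]_n,
    [/\ diagonalizable_mx B1, diagonalizable_mx B2, diagonalizable_mx B3
      & A = B1 + B2 + B3].

Lemma sum_of_3_conj m n (P : 'M[D]_(n, m)) (Q : 'M_(m, n)) (A : 'M_m) :
  P *m Q = 1%:M -> Q *m P = 1%:M ->
  sum_of_3_diagonalizable A -> sum_of_3_diagonalizable (P *m A *m Q).
Proof.
move=> PQ QP [B1 [B2 [B3 [dB1 dB2 dB3 ->]]]].
exists (P *m B1 *m Q), (P *m B2 *m Q), (P *m B3 *m Q).
by split; rewrite ?mulmxDr ?mulmxDl //; apply: diagonalizable_conj.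
Qed.

Lemma sum_of_3_block m n (A : 'M[D]_m) (B : 'M_n) :
  sum_of_3_diagonalizable A -> sum_of_3_diagonalizable B ->
  sum_of_3_diagonalizable (block_mx A 0 0 B).
Proof.
move=> [A1 [A2 [A3 [dA1 dA2 dA3 ->]]]] [B1 [B2 [B3 [dB1 dB2 dB3 ->]]]].
exists (block_mx A1 0 0 B1), (block_mx A2 0 0 B2), (block_mx A3 0 0 B3).
by split; rewrite ?add_block_mx ?addr0 //; apply: diagonalizable_block.
Qed.

Lemma companion_sum_of_3 p (C : 'M[D]_p.+1) : 1 + 1 = 0 :> D ->
  (forall i, i != ord_max -> row i C = 'e_(inord i.+1)) ->
  sum_of_3_diagonalizable C.
Proof.
move=> char2 rowC.
pose e i : 'rV[D]_p.+1 := 'e_i; pose s (i : 'I_p.+1) : 'I_p.+1 := inord i.+1.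
(* With this choice [d] below is -1 if the last diagonal entry of [C] is 0, and that entry
   otherwise. *)
pose x : D := (C ord_max ord_max == 0)%:R.
(* Parity counted from the last row puts the last row in [Q], so that adding
   [x] to its diagonal entry keeps [Q] idempotent. *)
pose b (i : 'I_p.+1) := odd (p - i).
have eK i (M : 'M_p.+1) : e i *m M = row i M by rewrite rowE.
have addee (u : 'rV[D]_p.+1) : u + u = 0.
  by rewrite -[u]scale1r -scalerDl char2 scale0r.
have xx : x * x = x by rewrite /x; case: eqP => _; rewrite ?mulr1 ?mulr0.
have b_neq i : b i -> i != ord_max.
  by apply: contraTneq => ->; rewrite /b subnn.
have bs i : i != ord_max -> b (s i) = ~~ b i.
  move=> /ltn_ord_max lt_ip; rewrite /b /s inordK ?ltnS //.
  by rewrite -[(p - i)%N](subnSK lt_ip) /= negbK.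
(* Since [b] alternates, [P] kills [e (s i)] when [b i] holds, and [Q] fixes [e (s i)] when [b i]
   fails and [i] is not last; so both are idempotent. On rows with [b i], the two copies of [e i]
   cancel in characteristic 2. *)
pose P := \matrix_i (if b i then e i + e (s i) else 0).
pose Q := \matrix_i
  (if b i then e i else if i == ord_max then x *: e i else e (s i)).
have PP : P *m P = P.
  apply/row_matrixP=> i; rewrite row_mul !rowK.
  case: ifP => [bi|_]; last by rewrite mul0mx.
  by rewrite mulmxDl !eK !rowK bi bs ?b_neq // bi addr0.
have QQ : Q *m Q = Q.
  apply/row_matrixP=> i; rewrite row_mul !rowK.
  case: ifPn => [bi|nbi]; first by rewrite eK rowK bi.
  case: eqP => [->|/eqP i_neq]; last by rewrite eK rowK bs // nbi.
  by rewrite -scalemxAl eK rowK /b subnn /= eqxx scalerA xx.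
pose rho : 'rV_p.+1 := row ord_max C - x *: e ord_max; pose d := rho 0 ord_max.
have d_unit : d \is a GRing.unit.
  rewrite /d !mxE !eqxx mulr1 /x; have [->|c_neq0] := eqVneq.
    by rewrite sub0r unitrN unitr1.
  by rewrite subr0; apply: D_div.
have CE : C = P + Q + delta_mx ord_max 0 *m rho.
  apply/row_matrixP=> i; rewrite !linearD /= !rowK row_mul.
  have [->|i_neq] := eqVneq i ord_max.
    rewrite /b subnn /= add0r (_ : row _ (delta_mx _ _) = 1%:M).
      by rewrite mul1mx addrC subrK.
    by apply/rowP=> j; rewrite ord1 !mxE !eqxx.
  rewrite (_ : row i (delta_mx _ _) = 0); last first.
    by apply/rowP=> j; rewrite !mxE (negPf i_neq).
  rewrite mul0mx addr0 rowC // -/(s i) -/(e _).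
  case: ifP => _; last by rewrite add0r.
  by rewrite addrAC addee add0r.
exists P, Q, (delta_mx ord_max 0 *m rho); split=> //.
- exact: idempotent_diagonalizable.
- exact: idempotent_diagonalizable.
(* The rank-one term is written as [X d Y] with [Y = d^-1 rho], so that [Y X = 1]. *)
have -> : delta_mx ord_max 0 *m rho =
          delta_mx ord_max 0 *m diag_mx (const_mx d) *m (d^-1 *: rho) :> 'M_p.+1.
  by rewrite diag_const_mx -mulmxA mul_scalar_mx scalerA mulrV // scale1r.
apply: diagonalizable_factor; rewrite -scalemxAl -colE.
by apply/rowP=> j; rewrite ord1 mxE mxE -/d mulVr // mxE eqxx.
Qed.

(** * Splitting off a companion block *)

Lemma hankel_right_inverse p (H : 'M[D]_p.+1) :
  (forall i j : 'I_p.+1, (i + j <= p)%N -> H i j = (i + j == p)%N%:R) ->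
  exists G : 'M_p.+1, H *m G = 1%:M.
Proof.
move=> HE; apply: right_inverse_exists => x xH.
suff x0 t : forall i : 'I_p.+1, (i + t = p)%N -> x 0 i = 0.
  by apply/rowP=> i; rewrite (x0 (p - i)%N) ?mxE // subnKC // -ltnS.
(* Column [t] of [x H = 0] isolates the entry of [x] at [p - t]: [H] vanishes before the
   antidiagonal, and the later entries of [x] are already known to be zero. *)
elim/ltn_ind: t => t IHt i itp.
have tp : (t < p.+1)%N by rewrite ltnS -itp leq_addl.
have := congr1 (fun y : 'rV_p.+1 => y 0 (Ordinal tp)) xH.
rewrite !mxE (bigD1 i) //= big1 ?addr0 => [|j j_neqi].
  by rewrite HE /= itp ?leqnn // eqxx mulr1.
have [le_jtp|lt_pjt] := leqP (j + t) p.
  rewrite HE //; case: eqP => [jtp|_]; last by rewrite mulr0.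
  by case/eqP: j_neqi; apply/val_inj/(@addIn t); rewrite itp.
rewrite (IHt (p - j)%N) ?mul0r //; last by rewrite subnKC // -ltnS.
by rewrite ltn_subLR // -ltnS.
Qed.

Lemma companion_summand n (A : 'M[D]_n) : (0 < n)%N ->
  exists p s (C : 'M_p.+1) (A' : 'M_s)
         (P : 'M_(n, p.+1 + s)) (Q : 'M_(p.+1 + s, n)),
    [/\ P *m Q = 1%:M, Q *m P = 1%:M, A = P *m block_mx C 0 0 A' *m Q
      & forall i, i != ord_max -> row i C = 'e_(inord i.+1)].
Proof.
move=> n_gt0.
pose dual m (v : 'rV[D]_n) (phi : 'cV[D]_n) := forall j, (j <= m)%N ->
  v *m A ^+ j *m phi = (j == m)%:R%:M.
pose K m (v : 'rV[D]_n) := \matrix_(i < m) (v *m A ^+ i).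
pose L m (phi : 'cV[D]_n) := \matrix_(a < n, j < m) (A ^+ j *m phi) a 0.
have colL m phi j : col j (L m phi) = A ^+ j *m phi.
  by apply/colP=> a; rewrite !mxE.
have KLE m v phi i j : (K m v *m L m phi) i j = (v *m A ^+ (i + j) *m phi) 0 0.
  rewrite exprD -mulmxE mulmxA -mulmxA !mxE; apply: eq_bigr => a _.
  by rewrite !mxE.
have hankel m v phi : dual m v phi ->
    exists G : 'M_m.+1, K m.+1 v *m L m.+1 phi *m G = 1%:M.
  move=> dual_m; apply: hankel_right_inverse => i j le_ijm.
  by rewrite KLE dual_m // mxE eqxx mulr1n.
have [||p [[v [phi dual_p]] maxp]] :=
    @exists_last (fun m => exists v phi, dual m v phi) n.
- have /row_dual[z ez] : 'e_(Ordinal n_gt0) != 0 :> 'rV[D]_n.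
    by apply/rV0Pn; exists (Ordinal n_gt0); rewrite mxE !eqxx oner_eq0.
  exists 'e_(Ordinal n_gt0), z => j; rewrite leqn0 => /eqP->.
  by rewrite expr0 mulmx1 eqxx.
(* The Hankel matrix factors through dimension [n], which bounds [m + 1] by [n]. *)
- move=> m [v [phi /hankel[G]]]; rewrite -mulmxA => /right_inverse_leq.
  exact: ltnW.
have [G KLG] := hankel _ _ _ dual_p.
set Kv := K p.+1 v in KLG; set Lp := L p.+1 phi in KLG.
have GKL := right_inverse_square KLG.
pose X := Lp *m G; have KX : Kv *m X = 1%:M by rewrite mulmxA.
(* The projection with the row space of [Kv] and the column space of [Lp]. *)
pose E := X *m Kv.
have KE : Kv *m E = Kv by rewrite mulmxA KX mul1mx.
have EL : E *m Lp = Lp by rewrite /E /X -!mulmxA GKL mulmx1.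
have rowKE (i : nat) : (i <= p)%N -> v *m A ^+ i *m E = v *m A ^+ i.
  by move=> le_ip; have := congr1 (row (Ordinal (le_ip : (i < p.+1)%N))) KE;
    rewrite row_mul rowK.
have colEL (i : nat) : (i <= p)%N -> E *m (A ^+ i *m phi) = A ^+ i *m phi.
  by move=> le_ip; have := congr1 (col (Ordinal (le_ip : (i < p.+1)%N))) EL;
    rewrite colE -mulmxA -colE colL.
have vAp : v *m A ^+ p.+1 *m E = v *m A ^+ p.+1.
  (* Otherwise some [(1 - E) z] pairs to 1 with [v A^(p+1)] and to 0 with every lower [v A^j],
     contradicting the maximality of [p]. *)
  apply/eqP; rewrite eq_sym -subr_eq0; apply: contra_notT maxp.
  move=> /row_dual[z]; rewrite -[X in X - _]mulmx1 -mulmxBr -mulmxA => vz.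
  exists v, ((1%:M - E) *m z) => j.
  rewrite leq_eqVlt ltnS => /predU1P[->|le_jp].
    by rewrite eqxx.
  rewrite mulmxA mulmxBr mulmx1 rowKE // subrr mul0mx.
  by rewrite eqn_leq ltnNge le_jp andbF raddf0.
have Aphi : E *m (A ^+ p.+1 *m phi) = A ^+ p.+1 *m phi.
  apply/eqP; rewrite eq_sym -subr_eq0; apply: contra_notT maxp.
  move=> /col_dual[z]; rewrite -[X in X - _]mul1mx -mulmxBl => zphi.
  exists (z *m (1%:M - E)), phi => j.
  rewrite leq_eqVlt ltnS => /predU1P[->|le_jp].
    by rewrite eqxx -zphi !mulmxA.
  rewrite -mulmxA -mulmxA mulmxBl mul1mx colEL // subrr mulmx0.
  by rewrite eqn_leq ltnNge le_jp andbF raddf0.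
have rowKA (i : 'I_p.+1) : row i (Kv *m A) = v *m A ^+ i.+1.
  by rewrite row_mul rowK exprSr -mulmxE mulmxA.
have KAE : Kv *m A *m E = Kv *m A.
  apply/row_matrixP=> i; rewrite row_mul rowKA.
  by have := ltn_ord i; rewrite ltnS leq_eqVlt => /predU1P[->|/rowKE].
have EAL : E *m (A *m Lp) = A *m Lp.
  apply/trmx_inj/row_matrixP=> i; rewrite -!tr_col; congr trmx.
  have colAL : col i (A *m Lp) = A ^+ i.+1 *m phi.
    by rewrite colE -mulmxA -colE colL exprS -mulmxE mulmxA.
  rewrite colE -mulmxA -colE colAL.
  by have := ltn_ord i; rewrite ltnS leq_eqVlt => /predU1P[->|/colEL].
(* Invariance of the row space gives [E A = E A E], that of the column space [A E = E A E]; hence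
   [A] commutes with [E]. *)
have EA : E *m A = E *m A *m E.
  by rewrite {1 2}/E -!mulmxA [Kv *m (A *m E)]mulmxA KAE.
have EAX : E *m (A *m X) = A *m X by rewrite /X (mulmxA A) mulmxA EAL.
have AE : A *m E = E *m A *m E.
  by rewrite {1 3}/E -mulmxA (mulmxA A) [E *m (_ *m _)]mulmxA EAX.
clearbody X.
have [s [X' [Y' [PQ QP]]]] := complement_factor KX.
exists p, s, (Kv *m A *m X), (Y' *m A *m X'), (row_mx X X'), (col_mx Kv Y').
split=> // [|i i_neq].
  (* The product is [E A E + (1 - E) A (1 - E)], which equals [A] by commutation. *)
  rewrite mul_row_block mul_row_col !mulmx0 addr0 add0r !mulmxA.
  have XY' : X' *m Y' = 1%:M - E by rewrite -PQ mul_row_col -/E addrAC subrr add0r.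
  rewrite XY' -/E -[E *m A *m X *m Kv]mulmxA -/E -EA -[_ *m X' *m Y']mulmxA XY'.
  rewrite mulmxBl mul1mx mulmxBr mulmx1 mulmxBl AE subrr subr0.
  by rewrite addrC subrK.
(* Row [i] of [Kv A] is row [i + 1] of [Kv], and [Kv X = 1]. *)
by rewrite row_mul rowKA -row1 -KX row_mul rowK inordK // ltnS ltn_ord_max.
Qed.

Lemma matrix_sum_of_3 n (A : 'M[D]_n) : 1 + 1 = 0 :> D ->
  sum_of_3_diagonalizable A.
Proof.
move=> char2; elim/ltn_ind: n A => n IHn A.
have [n0|n_gt0] := posnP n.
  by subst n; exists 0, 0, 0; split; rewrite ?[A]flatmx0 ?addr0 //;
    apply: idempotent_diagonalizable; rewrite mul0mx.
have [p [s [C [A' [P [Q [PQ QP -> rowC]]]]]]] := companion_summand A n_gt0.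
apply: sum_of_3_conj => //; apply: sum_of_3_block.
  exact: companion_sum_of_3.
apply: IHn; have := right_inverse_leq QP; apply: leq_trans.
by rewrite addSn ltnS leq_addl.
Qed.

End DivisionRing.

(** * Sharpness over the field of two elements *)

Lemma center_F2 : center_is_F2 'F_2.
Proof.
exists (GRing.RMorphism.clone _ _ (@idfun 'F_2) _); split=> // x.
by split=> [_|_ y]; [exists x | exact: mulrC].
Qed.

Lemma F2_diagonalizable_idempotent n (B : 'M['F_2]_n) :
  diagonalizable_mx B -> B *m B = B.
Proof.
move=> [d [P [Q [[_ QP] ->]]]].
rewrite -!mulmxA [Q *m _]mulmxA QP mul1mx [diag_mx d *m (_ *m _)]mulmxA.
rewrite mulmx_diag; congr (P *m (diag_mx _ *m Q)).
by apply/rowP=> j; rewrite mxE; case: (d 0 j) => [[|[|]]] // ?; apply/val_inj.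
Qed.

Lemma F2_not_sum_of_2 n (A : 'M['F_2]_n) : (0 < n)%N -> A *m A = A + 1%:M ->
  ~ exists B1 B2 : 'M['F_2]_n,
      [/\ diagonalizable_mx B1, diagonalizable_mx B2 & A = B1 + B2].
Proof.
move=> n_gt0 AA [B [C [/F2_diagonalizable_idempotent BB]]].
move=> /F2_diagonalizable_idempotent CC AE.
(* Expanding [(B + C)^2] with idempotent [B] and [C] gives [A + (B C + C B)], to be compared with
   [A + 1]. *)
have BC : B *m C + C *m B = 1%:M.
  apply: (addrI A); rewrite -AA AE mulmxDl !mulmxDr BB CC.
  by rewrite [C *m B + C]addrC [RHS]addrACA.
have B0 : B = 0.
  rewrite -BB -[B in B *m _]mulmx1 -BC mulmxDr mulmxDl !mulmxA BB.
  rewrite -!mulmxA BB -mulr2n -scaler_nat.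
  by rewrite (_ : 2%:R = 0) ?scale0r //; apply/val_inj.
have /matrixP/(_ (Ordinal n_gt0) (Ordinal n_gt0)) := BC.
by rewrite B0 mul0mx mulmx0 addr0 !mxE eqxx => /esym/eqP; rewrite oner_eq0.
Qed.

Theorem theorem2p7 :
  (forall (D : unitRingType) (n : nat),
     division_ring D -> (0 < n)%N -> center_is_F2 D ->
     forall A : 'M[D]_n,
       exists B1 B2 B3 : 'M[D]_n,
         [/\ diagonalizable_mx B1, diagonalizable_mx B2, diagonalizable_mx B3
           & A = B1 + B2 + B3])
  /\
  (exists (D : unitRingType) (n : nat) (A : 'M[D]_n),
     [/\ division_ring D, (0 < n)%N, center_is_F2 D
       & ~ exists B1 B2 : 'M[D]_n,
           [/\ diagonalizable_mx B1, diagonalizable_mx B2 & A = B1 + B2]]).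
Proof.
split=> [D n D_div _ [f _] A|].
  apply: matrix_sum_of_3 => //.
  by rewrite -(rmorph1 f) -rmorphD -(rmorph0 f); congr (f _); apply/val_inj.
(* The matrix with rows (0, 1) and (1, 1), the companion matrix of [X^2 + X + 1]. *)
exists 'F_2, 2%N, (\matrix_(i, j) ((i != 0) || (j != 0))%:R).
split=> //; [by move=> x; rewrite unitfE | exact: center_F2 |].
apply: F2_not_sum_of_2 => //; apply/matrixP=> i j.
rewrite !mxE !big_ord_recl big_ord0 !mxE.
by case: i => [[|[|]]] // ?; case: j => [[|[|]]] // ?; apply/val_inj.
Qed.
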